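(* For $|q|<1$, \[ \sum_{i,j\ge0}\frac{q^{2ij+i+j}}{(q;q)_{2i}(q;q)_{2j}}=\frac{1}{(q;q^2)_\infty^2(q^{2},q^{8};q^{10})_\infty} \] and \[ \sum_{i,j\ge0}\frac{q^{2ij+i+3j}}{(q;q)_{2i+1}(q;q)_{2j}}=\frac{1}{(q;q^2)_\infty^2(q^{4},q^{6};q^{10})_\infty}. \]
   Context: Standard $q$-Pochhammer notation: $(a;q)_\infty=\prod_{k\ge0}(1-aq^k)$, $(a;q)_n=(a;q)_\infty/(aq^n;q)_\infty$, and $(a_1,\dots,a_m;q)_n=\prod_{k=1}^m(a_k;q)_n$. *)

(* Defs.v *)
From mathcomp Require Import all_boot all_order all_algebra.
From mathcomp Require Import all_classical all_reals topology normedtype.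
From mathcomp Require Import sequences.
From mathcomp Require Import showcase.summability.

Set Implicit Arguments.
Unset Strict Implicit.
Unset Printing Implicit Defensive.

Import GRing.Theory Num.Theory numFieldNormedType.Exports.
Local Open Scope classical_set_scope.
Local Open Scope ring_scope.

(* The definitions are over an abstract numFieldType K because the norm
   topology is attached to numFieldType; the intended instance is K := R[i]
   with R : realType. *)

Definition qpoch_inf (K : numFieldType) (a q : K) : K :=
  lim ((fun n : nat => \prod_(k < n) (1 - a * q ^+ k)) @ \oo).

Definition qpoch (K : numFieldType) (a q : K) (n : nat) : K :=
  qpoch_inf a q / qpoch_inf (a * q ^+ n) q.

Definition qpochs_inf (K : numFieldType) (s : seq K) (q : K) : K :=
  \prod_(a <- s) qpoch_inf a q.

(* Unconditional convergence of a double series: the net of the sums over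
   finite sets of index pairs, directed by inclusion, converges to l; over the
   complex numbers this is the same as absolute convergence with sum l. *)
Definition is_double_sum (K : numFieldType) (f : nat -> nat -> K) (l : K) :
  Prop := partial_sum (fun p : nat * nat => f p.1 p.2) @ totally --> l.

(* Main.v *)
Require Import Defs.
From mathcomp Require Import all_boot all_order all_algebra.
From mathcomp Require Import complex.
From mathcomp Require Import reals.
From mathcomp Require Import finmap.
From mathcomp Require Import all_classical topology normedtype sequences exp.
From mathcomp Require Import showcase.summability.
From mathcomp Require Import ring zify.

Set Implicit Arguments.
Unset Strict Implicit.
Unset Printing Implicit Defensive.

Import Order.TTheory GRing.Theory Num.Theory numFieldNormedType.Exports.
Local Open Scope ring_scope.
Local Open Scope complex_scope.

(** Write [P = (q; q^2)_oo].  Euler's two identities and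
    [1 / (z; q)_oo = (- z; q)_oo / (z^2; q^2)_oo] give, on taking even parts in
    [z] and putting [w = z^2],
      [sum_j w^j / (q)_{2j} = 1/(w; q^2)_oo sum_m w^m q^{m(2m-1)} / (q)_{2m}].
    For [w = q^{2i+1}] (resp. [q^{2i+3}]) this sums the double series over [j];
    the sum over [i] is then Euler's again, and what remains is
    [P^-2 sum_m q^{2m^2} / (q^2; q^2)_m] (resp. [q^{2m^2+2m}]): a
    Rogers-Ramanujan sum in base [q^2].  The Rogers-Ramanujan identities are
    obtained by applying the Bailey lemma twice to the unit Bailey pair, and
    the resulting theta series is evaluated by the triple product, which itself
    comes from multiplying two Euler series and summing along diagonals with
      [sum_s q^{s^2 + c s} / ((q)_s (q)_{s+c}) = 1 / (q)_oo]. *)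

#[local] Existing Instance totally_filter.

(** * Unconditional sums *)

(** An arbitrary index type lets single and double series share one theory; at [nat * nat] this
    unfolds to the same limit as [is_double_sum]. *)
Definition is_sum (K : numFieldType) (I : choiceType) (f : I -> K) (l : K) :
  Prop := (partial_sum f @ totally --> l)%classic.

Section Sums.
Variable K : numFieldType.
Implicit Types (I J : choiceType) (l : K).

Lemma partial_sumE I (f : I -> K) A : partial_sum f A = \sum_(i <- A) f i.
Proof. by rewrite /partial_sum big_seq_fsetE. Qed.

Lemma is_sumP I (f : I -> K) l :
  is_sum f l <-> forall e : K, 0 < e -> exists A : {fset I},
    forall B : {fset I}, (A `<=` B)%fset -> `|l - \sum_(i <- B) f i| < e.
Proof.
split.
  move=> /cvgrPdist_lt fl e e0; have [A _ HA] := fl e e0.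
  by exists A => B AB; rewrite -partial_sumE; exact: HA.
move=> H; apply/cvgrPdist_lt => e e0; have [A HA] := H e e0.
by exists A => // B AB; rewrite /= partial_sumE; exact: HA.
Qed.

Lemma is_sum_ext I (f g : I -> K) l : f =1 g -> is_sum f l -> is_sum g l.
Proof. by move=> /funext ->. Qed.

Lemma is_sum_unique I (f : I -> K) l l' : is_sum f l -> is_sum f l' -> l = l'.
Proof. by move=> fl fl'; apply: (cvg_unique _ fl fl'). Qed.

Lemma is_sumD I (f g : I -> K) l l' :
  is_sum f l -> is_sum g l' -> is_sum (fun i => f i + g i) (l + l').
Proof.
move=> fl gl; rewrite /is_sum.
rewrite (_ : partial_sum _ = partial_sum f \+ partial_sum g); last first.
  by apply/funext => A /=; rewrite !partial_sumE big_split.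
exact: cvgD.
Qed.

Lemma is_sumZ I (f : I -> K) l c :
  is_sum f l -> is_sum (fun i => c * f i) (c * l).
Proof.
move=> fl; rewrite /is_sum.
rewrite (_ : partial_sum _ = (fun A => c * partial_sum f A)); last first.
  by apply/funext => A /=; rewrite !partial_sumE big_distrr.
by apply: cvgM => //; exact: cvg_cst.
Qed.

Lemma is_sumB I (f g : I -> K) l l' :
  is_sum f l -> is_sum g l' -> is_sum (fun i => f i - g i) (l - l').
Proof.
move=> fl /(is_sumZ (c := -1)); rewrite mulN1r => gl.
by apply: is_sum_ext (is_sumD fl gl) => i; rewrite mulN1r.
Qed.

Lemma is_sum_fset I (f : I -> K) (A : {fset I}) :
  (forall i, i \notin A -> f i = 0) -> is_sum f (\sum_(i <- A) f i).
Proof.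
move=> f0; apply/is_sumP => e e0; exists A => B AB.
rewrite -(big_fset_incl _ AB) ?subrr ?normr0// => i _ /f0 -> //.
Qed.

(** If [d] were below the distance, a finite set containing [A0] whose sum is close enough to [m]
    would violate the triangle inequality. *)
Lemma is_sum_dist_le I (f : I -> K) l m d (A0 : {fset I}) :
  (forall A : {fset I}, (A0 `<=` A)%fset -> `|l - \sum_(i <- A) f i| <= d) ->
  is_sum f m -> `|l - m| <= d.
Proof.
(* The order of [K] is only partial, so [d] must first be seen to be real; this follows from its
   dominating a norm. *)
move=> fd /is_sumP fm; have dr : d \is Num.real.
  by rewrite realE (le_trans _ (fd A0 (fsubset_refl A0))).
rewrite real_leNgt ?normr_real//; apply/negP => dl.
have [A HA] := fm (`|l - m| - d) ltac:(by rewrite subr_gt0).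
have {}HA := HA (A0 `|` A)%fset (fsubsetUr _ _).
have {}fd := fd (A0 `|` A)%fset (fsubsetUl _ _).
have := ler_distD (\sum_(i <- (A0 `|` A)%fset) f i) l m.
rewrite [X in _ <= _ + X]distrC => /le_lt_trans.
move=> /(_ _ (ler_ltD fd HA)); by rewrite (addrC d) subrK ltxx.
Qed.

Lemma is_sum_norm_le I (f : I -> K) l M :
  (forall A : {fset I}, `|\sum_(i <- A) f i| <= M) -> is_sum f l -> `|l| <= M.
Proof.
move=> fM fl; rewrite -normrN -sub0r.
by apply: (is_sum_dist_le (A0 := fset0)) fl => A _; rewrite sub0r normrN.
Qed.

(** Once [B] contains the first projections of [A], every rectangle on [B] and a [C] containing the
    second projections contains [A]. Its sum is thus within [e / 2] of [l], and the bound survives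
    the limit in [C], which turns the rectangle sum into a partial sum of [g]. *)
Lemma is_sum_fubini I J (f : I * J -> K) (g : I -> K) l :
  is_sum f l -> (forall i, is_sum (fun j => f (i, j)) (g i)) -> is_sum g l.
Proof.
move=> /is_sumP fl fg; apply/is_sumP => e e0.
have e20 : 0 < e / 2 by rewrite divr_gt0.
have [A HA] := fl _ e20; exists [fset p.1 | p in A]%fset => B AB.
have Bl : is_sum (fun j => \sum_(i <- B) f (i, j)) (\sum_(i <- B) g i).
  elim: (enum_fset B) => [|i s IH].
    have := @is_sum_fset J (fun=> 0) fset0 (fun _ _ => erefl).
    rewrite big_nil big_seq_fset0; apply: is_sum_ext => j; by rewrite big_nil.
  rewrite big_cons; apply: is_sum_ext (is_sumD (fg i) IH) => j.
  by rewrite big_cons.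
apply: (@le_lt_trans _ _ (e / 2)); last by rewrite ltr_pdivrMr// ltr_pMr// ltr1n.
apply: (is_sum_dist_le (A0 := [fset p.2 | p in A]%fset)) Bl => C AC.
have -> : \sum_(j <- C) \sum_(i <- B) f (i, j) = \sum_(p <- (B `*` C)%fset) f p.
  rewrite exchange_big /= /fsetM big_imfset2 //=.
  by move=> [? ?] [? ?] _ _ /= [-> ->].
apply/ltW/HA; apply/fsubsetP => -[i j] ijA; rewrite in_fsetM /=.
rewrite (fsubsetP AB) ?(fsubsetP AC)//; apply/imfsetP; by exists (i, j).
Qed.

Lemma is_sum_reindex I J (h : J -> I) (g : I -> option J) (f : I -> K) l :
  pcancel h g -> (forall i, (forall j, i <> h j) -> f i = 0) ->
  is_sum f l <-> is_sum (f \o h) l.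
Proof.
move=> hK f0; have hI := pcan_inj hK.
have sumh (A : {fset J}) : \sum_(i <- [fset h j | j in A]%fset) f i =
    \sum_(j <- A) (f \o h) j.
  by rewrite big_imfset //= => x y _ _; exact: hI.
(* [G A] is the preimage of [A] under [h]. The membership filter matters because [g] may return a
   value outside the image of [h]. *)
pose G (A : {fset I}) := [fset j in pmap g A | h j \in A]%fset.
have hG (A : {fset I}) j : (j \in G A) = (h j \in A).
  rewrite !inE /= mem_pmap andbC; case: (boolP (h j \in A)) => //= hjA.
  by apply/mapP; exists (h j) => //; rewrite hK.
split=> /is_sumP fl; apply/is_sumP => e /fl[A HA].
  exists (G A) => B AB; rewrite -sumh.
  have := HA (A `|` [fset h j | j in B])%fset (fsubsetUl _ _).
  congr (`|_ - _| < _); apply/esym/big_fset_incl => //; first exact: fsubsetUr.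
  move=> i; rewrite inE => /orP[iA iB|->//]; apply: f0 => j ij; subst i.
  move: iB; rewrite in_imfset//=; apply: (fsubsetP AB); by rewrite hG.
exists [fset h j | j in A]%fset => B AB.
have AG : (A `<=` G B)%fset.
  by apply/fsubsetP => j jA; rewrite hG; apply: (fsubsetP AB); rewrite in_imfset.
have := HA _ AG; congr (`|_ - _| < _); rewrite -sumh.
apply: big_fset_incl.
  by apply/fsubsetP => _ /imfsetP[j /= jG ->]; move: jG; rewrite hG.
move=> i iB iG; apply: f0 => j ij; subst i.
by move: iG; rewrite in_imfset//= hG.
Qed.
End Sums.

(* [R[i]] inherits a topology only through its [numFieldType] structure, hence
   limits are handled at that generality. *)
Definition tends_to (K : numFieldType) (u : nat -> K) (l : K) : Prop :=
  (u @ \oo --> l)%classic.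

(** * Sums over the natural numbers and geometric majorants *)

Section NatSums.
Variable K : numFieldType.

Lemma ler_sum_subset (T : eqType) (s t : seq T) (f : T -> K) :
  uniq s -> uniq t -> {subset s <= t} -> (forall i, 0 <= f i) ->
  \sum_(i <- s) f i <= \sum_(i <- t) f i.
Proof.
move=> us ut st f0.
have /(perm_big _) -> : perm_eq s [seq i <- t | i \in s].
  apply: uniq_perm; rewrite ?filter_uniq// => i; rewrite mem_filter /=.
  by case: (boolP (i \in s)) => //= /st ->.
by rewrite big_filter big_mkcond /=; apply: ler_sum => i _; case: ifP.
Qed.

Lemma sum_geo_le (r : K) n : 0 <= r < 1 ->
  \sum_(i <- iota 0 n) r ^+ i <= (1 - r)^-1.
Proof.
move=> /andP[r0 r1]; have r10 : 0 < 1 - r by rewrite subr_gt0.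
rewrite -[X in iota 0 X]subn0 -/(index_iota 0 n) big_mkord.
rewrite -[X in _ <= X]mul1r ler_pdivlMr// mulrC -opprB mulNr -subrX1 opprB.
by rewrite gerBl exprn_ge0.
Qed.

Lemma fset_sum_geo_le (r : K) (A : {fset nat}) : 0 <= r < 1 ->
  \sum_(i <- A) r ^+ i <= (1 - r)^-1.
Proof.
move=> r01; apply: (le_trans _ (sum_geo_le (\max_(i <- A) i.+1) r01)).
apply: ler_sum_subset; rewrite ?iota_uniq ?fset_uniq//.
  move=> i iA; rewrite mem_iota /= add0n.
  by rewrite (leq_bigmax_seq (F := S) (P := xpredT)).
by move=> i; rewrite exprn_ge0//; case/andP: r01.
Qed.

Lemma fset_sum_geo2_le (r : K) (A : {fset nat * nat}) : 0 <= r < 1 ->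
  \sum_(p <- A) r ^+ (p.1 + p.2) <= (1 - r)^-1 * (1 - r)^-1.
Proof.
move=> r01; have r0 : 0 <= r by case/andP: r01.
set n := \max_(p <- A) (p.1 + p.2).+1.
apply: (@le_trans _ _ (\sum_(p <- [seq (i, j) | i <- iota 0 n, j <- iota 0 n])
    r ^+ (p.1 + p.2))).
  apply: ler_sum_subset; rewrite ?fset_uniq//.
  - by rewrite allpairs_uniq ?iota_uniq// => -[? ?] [? ?] _ _ [-> ->].
  - move=> [i j] iA.
    have := leq_bigmax_seq (F := fun p : nat * nat => (p.1 + p.2).+1)
       (P := xpredT) _ iA isT; rewrite -/n /= => ijn.
    by apply/allpairsP; exists (i, j); rewrite !mem_iota /=; split=> //; lia.
  - by move=> i; rewrite exprn_ge0.
rewrite big_allpairs /=.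
under eq_bigr do under eq_bigr do rewrite exprD.
under eq_bigr do rewrite -big_distrr /=.
rewrite -big_distrl /= ler_pM ?sum_geo_le// sumr_ge0// => i _.
  by rewrite exprn_ge0.
by rewrite exprn_ge0.
Qed.

Lemma is_sum_prefix (f : nat -> K) n :
  (forall i, (n <= i)%N -> f i = 0) -> is_sum f (\sum_(i < n) f i).
Proof.
move=> f0.
have := @is_sum_fset _ _ f [fset i in iota 0 n]%fset.
rewrite (perm_big _ (enum_imfset _ _)) //= map_id undup_id ?iota_uniq // => H.
rewrite -(big_mkord xpredT f) /index_iota subn0; apply: H => i.
by rewrite !inE mem_iota /= add0n -leqNgt; exact: f0.
Qed.

Lemma is_sum_shift (f : nat -> K) l :
  is_sum f l -> is_sum (fun n => f n.+1) (l - f 0%N).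
Proof.
move=> fl; have := @is_sum_prefix (fun n => if n == 0%N then f 0%N else 0) 1.
rewrite big_ord1 /= => /(_ _)/(is_sumB fl) H.
have {}H := H ltac:(by case).
have [||H1 _] := @is_sum_reindex K _ _ S
    (fun n => if n is m.+1 then Some m else None)
    (fun n => f n - (if n == 0%N then f 0%N else 0)) (l - f 0%N).
- by [].
- by case=> [|n] Hn /=; [rewrite subrr | case: (Hn n)].
by apply: is_sum_ext (H1 H) => n /=; rewrite subr0.
Qed.

Lemma is_sum_tends_to (f : nat -> K) l :
  is_sum f l -> tends_to (fun n => \sum_(i < n) f i) l.
Proof.
move=> /is_sumP fl; rewrite /tends_to; apply/cvgrPdist_lt => e /fl[A HA].
near=> n; have nA : (\max_(i <- A) i.+1 <= n)%N by near: n; exact: nbhs_infty_ge.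
have := HA [fset i in iota 0 n]%fset.
rewrite (perm_big _ (enum_imfset _ _)) //= map_id undup_id ?iota_uniq//.
rewrite -(big_mkord xpredT f) /index_iota subn0; apply; apply/fsubsetP => i iA; rewrite !inE mem_iota /= add0n.
by apply: leq_trans nA; rewrite (leq_bigmax_seq (F := S) (P := xpredT)).
Unshelve. all: by end_near. Qed.

End NatSums.

(** * Absolute summability of real and complex families *)

Section Summable.
Variable R : realType.
Implicit Types I : choiceType.

Lemma nneg_summable I (u : I -> R) (M : R) : (forall i, 0 <= u i) ->
  (forall A : {fset I}, \sum_(i <- A) u i <= M) -> exists l, is_sum u l.
Proof.
move=> u0 uM; pose S := [set x | exists A : {fset I}, x = \sum_(i <- A) u i]%classic.
have S0 : has_sup S.
  split; first by exists (\sum_(i <- fset0) u i), fset0.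
  by exists M => _ [A ->].
exists (sup S); apply/is_sumP => e e0.
have [_ [A ->] HA] := sup_adherent e0 S0; exists A => B AB.
have AuB : \sum_(i <- A) u i <= \sum_(i <- B) u i.
  by apply: ler_sum_subset => //; exact/fsubsetP.
have BS : \sum_(i <- B) u i <= sup S.
  by apply: sup_upper_bound => //; exists B.
by rewrite ger0_norm ?subr_ge0// ltrBlDl -ltrBlDr (lt_le_trans HA).
Qed.

(** Both [|u| + u] and [|u|] are nonnegative with bounded finite sums, and [u] is their
    difference. *)
Lemma real_summable I (u : I -> R) (M : R) :
  (forall A : {fset I}, \sum_(i <- A) `|u i| <= M) -> exists l, is_sum u l.
Proof.
move=> uM.
have [l1 H1] := nneg_summable (fun i => normr_ge0 (u i)) uM.
have [||l2 H2] := @nneg_summable _ (fun i => `|u i| + u i) (M + M).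
- by move=> i; rewrite -lerBlDr sub0r -normrN ler_norm.
- move=> A; rewrite big_split /= lerD//; apply: le_trans (uM A).
  by apply: ler_sum => i _; exact: ler_norm.
exists (l2 - l1); apply: is_sum_ext (is_sumB H2 H1) => i.
by rewrite addrAC subrr add0r.
Qed.

Lemma norm_real_complex (x : R) : `|x%:C| = `|x|%:C.
Proof.
have [x0|/ltW x0] := leP 0 x; first by rewrite !ger0_norm ?ler0c.
by rewrite !ler0_norm ?lecR // rmorphN.
Qed.

Lemma is_sum_real_complex I (u : I -> R) l :
  is_sum u l -> is_sum (fun i => (u i)%:C) l%:C.
Proof.
move=> /is_sumP ul; apply/is_sumP => e e0.
have /RRe_real eE := gtr0_real e0; rewrite -eE ltcR in e0 *.
have [A HA] := ul _ e0; exists A => B /HA.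
by rewrite -rmorph_sum -rmorphB norm_real_complex ltcR.
Qed.

Lemma abs_summable I (f : I -> R[i]) (M : R[i]) :
  (forall A : {fset I}, \sum_(i <- A) `|f i| <= M) -> exists l, is_sum f l.
Proof.
move=> fM.
have part (u : I -> R) : (forall i, `|u i|%:C <= `|f i|) ->
    exists l, is_sum u l.
  move=> uf; apply: (@real_summable _ _ (complex.Re M)) => A.
  have Mr : M \is Num.real.
    by apply: ger0_real; rewrite (le_trans _ (fM fset0))// sumr_ge0.
  rewrite -lecR RRe_real// rmorph_sum (le_trans _ (fM A))//=.
  exact: ler_sum.
have [l1 /is_sum_real_complex H1] : exists l, is_sum (fun i => complex.Re (f i)) l.
  by apply: part => i; exact: normc_ge_Re.
have [l2 /is_sum_real_complex H2] : exists l, is_sum (fun i => complex.Im (f i)) l.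
  (* Up to sign, the imaginary part of [f i] is the real part of [f i * 'i], so the bound on real
     parts covers it too. *)
  apply: part => i; have := normc_ge_Re (f i * 'i%C).
  by rewrite ReiNIm normrN normrM complexiE normCi mulr1.
exists (l1%:C + 'i%C * l2%:C).
apply: is_sum_ext (is_sumD H1 (is_sumZ (c := 'i%C) H2)) => i.
by rewrite -complexE.
Qed.

Lemma geo_summable (f : nat -> R[i]) (C r : R[i]) : 0 <= r < 1 ->
  (forall i, `|f i| <= C * r ^+ i) -> exists l, is_sum f l.
Proof.
move=> r01 fC.
have C0 : 0 <= C by have := fC 0%N; rewrite mulr1; exact: le_trans.
apply: (@abs_summable _ _ (C * (1 - r)^-1)) => A.
apply: (@le_trans _ _ (\sum_(i <- A) C * r ^+ i)); first exact: ler_sum.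
by rewrite -big_distrr ler_wpM2l// fset_sum_geo_le.
Qed.

Lemma geo_summable2 (f : nat * nat -> R[i]) (C r : R[i]) : 0 <= r < 1 ->
  (forall p, `|f p| <= C * r ^+ (p.1 + p.2)) -> exists l, is_sum f l.
Proof.
move=> r01 fC.
have C0 : 0 <= C by have := fC (0%N, 0%N); rewrite mulr1; exact: le_trans.
apply: (@abs_summable _ _ (C * ((1 - r)^-1 * (1 - r)^-1))) => A.
apply: (@le_trans _ _ (\sum_(p <- A) C * r ^+ (p.1 + p.2))); first exact: ler_sum.
by rewrite -big_distrr ler_wpM2l// fset_sum_geo2_le.
Qed.
End Summable.

(** * Infinite products *)

Definition qp (K : numFieldType) (a q : K) (n : nat) : K :=
  \prod_(k < n) (1 - a * q ^+ k).

(** * Limits of sequences *)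

Section SequenceLimits.
Variable K : numFieldType.
Implicit Types (u v : nat -> K) (l m : K).

Lemma tends_to_unique u l m : tends_to u l -> tends_to u m -> l = m.
Proof. by move=> ul um; apply: (cvg_unique _ ul um). Qed.

Lemma tends_to_ext u v l : u =1 v -> tends_to u l -> tends_to v l.
Proof. by move=> /funext ->. Qed.

Lemma tends_to_cst l : tends_to (fun=> l) l.
Proof. exact: cvg_cst. Qed.

Lemma tends_toD u v l m :
  tends_to u l -> tends_to v m -> tends_to (fun n => u n + v n) (l + m).
Proof. exact: cvgD. Qed.

Lemma tends_toM u v l m :
  tends_to u l -> tends_to v m -> tends_to (fun n => u n * v n) (l * m).
Proof. exact: cvgM. Qed.

Lemma tends_toV u l : l != 0 -> tends_to u l -> tends_to (fun n => (u n)^-1) l^-1.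
Proof. by move=> l0 ul; exact: cvgV. Qed.

Lemma tends_to_subseq u l (h : nat -> nat) :
  (forall n, (n <= h n)%N) -> tends_to u l -> tends_to (fun n => u (h n)) l.
Proof.
move=> hn; apply: cvg_comp => A [n _ An]; exists n => // m /= nm.
by apply: An => /=; exact: leq_trans (hn m).
Qed.

Lemma is_sum_tends_to0 (f : nat -> K) l : is_sum f l -> tends_to f 0.
Proof.
move=> /is_sum_tends_to fl; apply: cvg_series_cvg_0; apply/cvg_ex; exists l.
rewrite (_ : series _ = fun n => \sum_(i < n) f i)//.
by apply/funext => n; rewrite /series /= big_mkord.
Qed.

Lemma tends_to0P u :
  tends_to u 0 <-> forall e, 0 < e -> exists N, forall n, (N <= n)%N -> `|u n| < e.
Proof.
split=> [/cvgr0Pnorm_lt u0 e /u0 [N _ HN]|u0]; first by exists N.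
by apply/cvgr0Pnorm_lt => e /u0[N HN]; exists N.
Qed.

Lemma tends_to_dominated0 u v :
  (forall n, `|u n| <= v n) -> tends_to v 0 -> tends_to u 0.
Proof.
move=> uv /tends_to0P v0; apply/tends_to0P => e /v0[N HN]; exists N => n /HN.
apply: le_lt_trans; rewrite (le_trans (uv n))// real_ler_norm// realE.
by rewrite (le_trans _ (uv n)).
Qed.

Lemma tends_to_qpoch_inf (a q l : K) : tends_to (qp a q) l -> qpoch_inf a q = l.
Proof. by move=> H; apply: (cvg_lim _ H). Qed.

End SequenceLimits.

(** * Convergence and non-vanishing of q-products *)

Section Limits.
Variable R : realType.
Local Notation C := R[i].

Lemma expr_tends_to0 (r : C) : 0 <= r < 1 -> tends_to (fun n => r ^+ n) 0.
Proof.
move=> r01; have r0 : 0 <= r by case/andP: r01.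
have [|l /is_sum_tends_to0//] := @geo_summable R (fun n => r ^+ n) 1 r r01.
by move=> i; rewrite mul1r ger0_norm// exprn_ge0.
Qed.

(** A form of Tannery's theorem: past the head, the terms are bounded by [D * r ^+ n] times a
    geometric series, so only the head survives as [n] grows. It fixes the constants left open by
    the functional equations of the series below. *)
Lemma is_sum_head_limit (f : nat -> nat -> C) (l : nat -> C) g D r :
  0 <= r < 1 -> (forall n, is_sum (f n) (l n)) ->
  tends_to (fun n => f n 0%N) g ->
  (forall n i, `|f n i.+1| <= D * r ^+ n * r ^+ i) ->
  tends_to l g.
Proof.
move=> r01 fl f0 fD.
have lf n : `|l n - f n 0%N| <= D * r ^+ n * (1 - r)^-1.
  have Dr0 : 0 <= D * r ^+ n.
    by have := fD n 0%N; rewrite mulr1; apply: le_trans.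
  apply: is_sum_norm_le (is_sum_shift (fl n)) => A.
  apply: (le_trans (ler_norm_sum _ _ _)).
  apply: (@le_trans _ _ (\sum_(i <- A) D * r ^+ n * r ^+ i)).
    by apply: ler_sum => i _.
  by rewrite -big_distrr ler_wpM2l// fset_sum_geo_le.
apply: (@tends_to_ext _ (fun n => f n 0%N + (l n - f n 0%N))).
  by move=> n; rewrite addrC subrK.
rewrite -[g]addr0; apply: (tends_toD f0); apply: tends_to_dominated0 lf _.
rewrite -(mul0r (1 - r)^-1) -(mulr0 D).
apply: tends_toM; last exact: tends_to_cst.
by apply: tends_toM; [exact: tends_to_cst | exact: expr_tends_to0].
Qed.

Lemma prod1D_le_expR (c r : R) n : 0 <= c -> 0 <= r < 1 ->
  \prod_(k < n) (1 + c * r ^+ k) <= expR (c / (1 - r)).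
Proof.
move=> c0 r01; have r0 : 0 <= r by case/andP: r01.
apply: (@le_trans _ _ (expR (\sum_(k < n) c * r ^+ k))).
  rewrite expR_sum; apply: ler_prod => k _.
  by rewrite addr_ge0 ?mulr_ge0 ?exprn_ge0//= expR_ge1Dx.
rewrite ler_expR -big_distrr ler_wpM2l//=.
rewrite -(big_mkord xpredT (fun i => r ^+ i)) /index_iota subn0.
exact: sum_geo_le.
Qed.

Lemma prod1D_bounded (c r : C) : 0 <= c -> 0 <= r < 1 ->
  exists B : C, forall n, \prod_(k < n) (1 + c * r ^+ k) <= B.
Proof.
move=> c0 r01; have r0 : 0 <= r by case/andP: r01.
(* A complex number that is nonnegative for the complex order is real, so the exponential bound can
   be imported from [R]. *)
have [c' cE] := complex_realP _ (ger0_real c0).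
have [r' rE] := complex_realP _ (ger0_real r0).
move: c0 r01; rewrite {}cE {}rE !lecR ltcR => c0 r01.
exists (expR (c' / (1 - r')))%:C => n.
have := prod1D_le_expR n c0 r01; rewrite -lecR rmorph_prod /=.
by under eq_bigr do rewrite rmorphD rmorph1 rmorphM rmorphXn.
Qed.

Lemma qpS (a q : C) n : qp a q n.+1 = qp a q n * (1 - a * q ^+ n).
Proof. by rewrite /qp big_ord_recr. Qed.

Lemma qp0 (a q : C) : qp a q 0 = 1.
Proof. by rewrite /qp big_ord0. Qed.

Lemma qpD (a q : C) m n : qp a q (m + n) = qp a q m * qp (a * q ^+ m) q n.
Proof.
elim: n => [|n IH]; first by rewrite addn0 qp0 mulr1.
by rewrite addnS !qpS IH -!mulrA exprD.
Qed.

Lemma qp_bounded (a q : C) : `|q| < 1 -> exists B : C, forall n, `|qp a q n| <= B.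
Proof.
move=> q1.
have [|B HB] := @prod1D_bounded `|a| `|q| (normr_ge0 _); first by rewrite normr_ge0.
exists B => n; apply: le_trans (HB n); rewrite normr_prod; apply: ler_prod => k _.
by rewrite normr_ge0 /= (le_trans (ler_normB _ _))// normr1 normrM normrX.
Qed.

Lemma norm_mulX_lt1 (a q : C) k : `|a| < 1 -> `|q| < 1 -> `|a * q ^+ k| < 1.
Proof.
move=> a1 q1; rewrite normrM normrX (le_lt_trans _ a1)// ler_piMr//.
by rewrite exprn_ile1// ltW.
Qed.

Lemma norm_lt1_sub_neq0 (x : C) : `|x| < 1 -> 1 - x != 0.
Proof.
move=> x1; rewrite subr_eq0; apply: contraTneq x1 => <-.
by rewrite normr1 ltxx.
Qed.

Lemma qp_neq0 (a q : C) n : `|a| < 1 -> `|q| < 1 -> qp a q n != 0.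
Proof.
move=> a1 q1; apply/prodf_neq0 => k _.
by rewrite norm_lt1_sub_neq0// norm_mulX_lt1.
Qed.

(* [1 / (1 - x) = 1 + x / (1 - x)] bounds the inverse product by a product of
   the previous kind. *)
Lemma qpV_bounded (a q : C) : `|a| < 1 -> `|q| < 1 ->
  exists2 B : C, 0 < B & forall n, `|(qp a q n)^-1| <= B.
Proof.
move=> a1 q1; have a10 : 0 < 1 - `|a| by rewrite subr_gt0.
have [||B HB] := @prod1D_bounded (`|a| / (1 - `|a|)) `|q|.
- by rewrite divr_ge0// ltW.
- by rewrite normr_ge0.
exists B; first by have := HB 0%N; rewrite big_ord0; apply: lt_le_trans.
move=> n; apply: le_trans (HB n).
rewrite /qp -prodfV normr_prod; apply: ler_prod => k _; rewrite normr_ge0 /=.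
set x := a * q ^+ k; have xa : `|x| <= `|a|.
  by rewrite normrM normrX ler_piMr// exprn_ile1// ltW.
have x1 : 0 < 1 - `|x| by rewrite subr_gt0 (le_lt_trans xa).
have H : 1 - `|x| <= `|1 - x|.
  by have := lerB_dist 1 x; rewrite normr1.
rewrite normfV (@le_trans _ _ (1 - `|x|)^-1)//.
  by rewrite lef_pV2// posrE// (lt_le_trans x1).
rewrite (_ : (1 - `|x|)^-1 = 1 + `|x| / (1 - `|x|)); last first.
  apply: (mulIf (lt0r_neq0 x1)).
  by rewrite mulVf ?lt0r_neq0// mulrDl mul1r divfK ?lt0r_neq0// subrK.
rewrite lerD2l mulrAC -normrX -normrM -/x ler_wpM2l// lef_pV2 ?posrE//.
by rewrite lerB.
Qed.

(** Consecutive partial products differ by [- qp a q n * a * q ^+ n], which is geometrically small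
    since the partial products are bounded; the differences telescope. *)
Lemma qp_tends_to (a q : C) : `|q| < 1 -> tends_to (qp a q) (qpoch_inf a q).
Proof.
move=> q1; have [B HB] := qp_bounded a q1.
have [||l /is_sum_tends_to Hl] := @geo_summable R (fun n => qp a q n.+1 - qp a q n)
   (B * `|a|) `|q|; first by rewrite normr_ge0.
  move=> n; rewrite qpS mulrBr mulr1 addrAC subrr sub0r normrN normrM.
  by rewrite -mulrA normrM normrX ler_wpM2r// mulr_ge0// exprn_ge0.
suff H : tends_to (qp a q) (1 + l) by rewrite (tends_to_qpoch_inf H).
have := tends_toD (tends_to_cst (l := (1 : C))) Hl.
apply: tends_to_ext => n.
rewrite -(big_mkord xpredT (fun i => qp a q i.+1 - qp a q i)).
by rewrite telescope_sumr// qp0 addrC subrK.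
Qed.

(** A zero limit would make some partial product smaller than [B^-1], against the uniform bound [B]
    on the inverses. *)
Lemma qpoch_inf_neq0 (a q : C) : `|a| < 1 -> `|q| < 1 -> qpoch_inf a q != 0.
Proof.
move=> a1 q1; have [B B0 HB] := qpV_bounded a1 q1; apply/eqP => l0.
have := qp_tends_to (a := a) q1; rewrite l0 => /tends_to0P /(_ B^-1).
rewrite invr_gt0 => /(_ B0) [n /(_ n (leqnn n))].
have qn := qp_neq0 n a1 q1.
rewrite -ltf_pV2 ?posrE ?invr_gt0 ?normr_gt0// invrK -normfV.
by move=> /(le_lt_trans (HB n)); rewrite ltxx.
Qed.

Lemma qpoch_infM (a q : C) n : `|q| < 1 ->
  qpoch_inf a q = qp a q n * qpoch_inf (a * q ^+ n) q.
Proof.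
move=> q1; apply: (@tends_to_unique _ (fun m => qp a q (n + m))).
  by apply: tends_to_subseq (qp_tends_to (a := a) q1) => m; exact: leq_addl.
apply: (@tends_to_ext _ (fun m => qp a q n * qp (a * q ^+ n) q m)).
  by move=> m; rewrite qpD.
by apply: tends_toM; [exact: tends_to_cst | exact: qp_tends_to].
Qed.

(** The quotient defining [qpoch] simplifies because its denominator, the infinite tail product, is
    nonzero. *)
Lemma qpochE (a q : C) n : `|a| < 1 -> `|q| < 1 -> qpoch a q n = qp a q n.
Proof.
move=> a1 q1; rewrite /qpoch (qpoch_infM a n q1) mulfK// qpoch_inf_neq0//.
exact: norm_mulX_lt1.
Qed.

End Limits.

(** * Euler's identities *)

Section Euler.
Variable R : realType.
Local Notation C := R[i].
Variable q : C.
Hypothesis q1 : `|q| < 1.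
Local Notation "`( n )" := (qp q q n) (at level 0, format "`( n )").

Lemma qqS n : `(n.+1) = `(n) * (1 - q ^+ n.+1).
Proof. by rewrite qpS exprS. Qed.

Lemma qq_neq0 n : `(n) != 0.
Proof. exact: qp_neq0. Qed.

Lemma subX_neq0 n : 1 - q ^+ n.+1 != 0.
Proof. by rewrite norm_lt1_sub_neq0// exprS norm_mulX_lt1. Qed.

Lemma common_ratio (x : C) : `|x| < 1 ->
  exists r : C, [/\ 0 <= r < 1, `|x| <= r & `|q| <= r].
Proof.
(* This ratio is at least both norms and stays below 1, without any case distinction on which norm
   is larger. *)
move=> x1; exists (1 - (1 - `|x|) * (1 - `|q|)).
have x0 : 0 < 1 - `|x| by rewrite subr_gt0.
have q0 : 0 < 1 - `|q| by rewrite subr_gt0.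
have xE : 1 - (1 - `|x|) * (1 - `|q|) = `|x| + (1 - `|x|) * `|q| by ring.
have qE : 1 - (1 - `|x|) * (1 - `|q|) = `|q| + (1 - `|q|) * `|x| by ring.
split; [apply/andP; split | |].
- by rewrite xE addr_ge0// mulr_ge0// ltW.
- by rewrite gtrBl mulr_gt0.
- by rewrite xE lerDl mulr_ge0// ltW.
- by rewrite qE lerDl mulr_ge0// ltW.
Qed.

Lemma normX_le (r : C) m n : `|q| <= r -> r < 1 -> (n <= m)%N ->
  `|q ^+ m| <= r ^+ n.
Proof.
move=> qr r1 nm; have r0 : 0 <= r by apply: le_trans qr.
rewrite normrX (@le_trans _ _ (r ^+ m))//; first by rewrite lerXn2r// nnegrE.
by rewrite ler_wiXn2l// ltW.
Qed.

(** Let [l n] be the sum of the series at [x * q ^+ n]. The functional equation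
    [l n.+1 = (1 - x * q ^+ n) * l n] gives [l n = qp x q n * l 0], and [l] tends to 1, so [l 0] is
    the inverse product. *)
Lemma is_sum_euler_inv (x : C) : `|x| < 1 ->
  is_sum (fun n => x ^+ n / `(n)) (qpoch_inf x q)^-1.
Proof.
move=> x1; have [B B0 HB] := qpV_bounded q1 q1.
have [r [r01 xr qr]] := common_ratio x1; have [r0 r1] := andP r01.
pose f n i := (x * q ^+ n) ^+ i / `(i).
have f0 n : f n 0%N = 1 by rewrite /f expr0 qp0 divr1.
have xn n : `|x * q ^+ n| <= r * r ^+ n.
  by rewrite normrM ler_pM// normX_le.
have /boolp.choice[l Hl] : forall n, exists l : C, is_sum (f n) l.
  move=> n; apply: (@geo_summable R _ B r r01) => i.
  rewrite normrM mulrC ler_pM// normrX lerXn2r ?nnegrE//.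
  by rewrite (le_trans (xn n))// ler_piMr// exprn_ile1// ltW.
(* In the difference of the two series the head terms cancel, and the factor [1 - q ^+ i.+1] that
   appears cancels the last factor of the denominator. *)
have step n : l n.+1 = (1 - x * q ^+ n) * l n.
  have H := is_sum_shift (is_sumB (Hl n) (Hl n.+1)).
  have {}H : is_sum (fun i => x * q ^+ n * f n i) (l n - l n.+1).
    move: H; rewrite !f0 subrr subr0; apply: is_sum_ext => i.
    rewrite /f qqS (_ : x * q ^+ n.+1 = x * q ^+ n * q); last by rewrite exprSr mulrA.
    have := qq_neq0 i; have := subX_neq0 i.
    set a := x * q ^+ n; rewrite [(a * q) ^+ _]exprMn [a ^+ i.+1]exprS.
    by set p := `(i) => ? ?; field; apply/andP.
  have HE := is_sum_unique H (is_sumZ (c := x * q ^+ n) (Hl n)).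
  by rewrite mulrBl mul1r -HE subKr.
have lE n : l n = qp x q n * l 0%N.
  elim: n => [|n IH]; first by rewrite qp0 mul1r.
  by rewrite step IH qpS mulrA [_ * qp _ _ _]mulrC.
have l1 : tends_to l 1.
  apply: (is_sum_head_limit (D := B) r01 Hl).
    apply: (@tends_to_ext _ (fun=> 1)); last exact: tends_to_cst.
    by move=> n; rewrite f0.
  move=> n i; rewrite /f normrM mulrC -mulrA ler_pM// normrX exprS.
  have xn' : `|x * q ^+ n| <= r ^+ n.
    by rewrite (le_trans (xn n))// ler_piMl ?exprn_ge0// ltW.
  rewrite ler_pM ?exprn_ge0// lerXn2r ?nnegrE//.
  by rewrite (le_trans (xn n))// ler_piMr// exprn_ile1// ltW.
have lim : qpoch_inf x q * l 0%N = 1.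
  apply: tends_to_unique l1.
  apply: (@tends_to_ext _ (fun n => qp x q n * l 0%N)) => [n|]; first by rewrite -lE.
  by apply: tends_toM; [exact: qp_tends_to | exact: tends_to_cst].
have -> : (qpoch_inf x q)^-1 = l 0%N.
  by apply: (mulfI (qpoch_inf_neq0 x1 q1)); rewrite lim divff// qpoch_inf_neq0.
by apply: is_sum_ext (Hl 0%N) => i; rewrite /f mulr1.
Qed.

(** Same method, with the functional equation running the other way:
    [l n = (1 + z * q ^+ n) * l n.+1]. *)
Lemma is_sum_euler (z : C) : `|z| < 1 ->
  is_sum (fun k => z ^+ k * q ^+ 'C(k, 2) / `(k)) (qpoch_inf (- z) q).
Proof.
move=> z1; have [B B0 HB] := qpV_bounded q1 q1.
have [r [r01 zr qr]] := common_ratio z1; have [r0 r1] := andP r01.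
pose f n i := (z * q ^+ n) ^+ i * q ^+ 'C(i, 2) / `(i).
have f0 n : f n 0%N = 1 by rewrite /f !expr0 qp0 divr1 mulr1.
have zn n : `|z * q ^+ n| <= r * r ^+ n.
  by rewrite normrM ler_pM// normX_le.
have q_le n : `|q ^+ n| <= 1 by rewrite normrX exprn_ile1// ltW.
have /boolp.choice[l Hl] : forall n, exists l : C, is_sum (f n) l.
  move=> n; apply: (@geo_summable R _ B r r01) => i.
  rewrite normrM mulrC ler_pM// normrM (le_trans (ler_piMr _ (q_le _)))//.
  rewrite normrX lerXn2r ?nnegrE//.
  by rewrite (le_trans (zn n))// ler_piMr// exprn_ile1// ltW.
have step n : l n = (1 + z * q ^+ n) * l n.+1.
  have H := is_sum_shift (is_sumB (Hl n) (Hl n.+1)).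
  have {}H : is_sum (fun i => z * q ^+ n * f n.+1 i) (l n - l n.+1).
    move: H; rewrite !f0 subrr subr0; apply: is_sum_ext => i.
    rewrite /f qqS binS bin1 exprD.
    rewrite (_ : z * q ^+ n.+1 = z * q ^+ n * q); last by rewrite exprSr mulrA.
    have := qq_neq0 i; have := subX_neq0 i.
    set a := z * q ^+ n.
    rewrite ![(a * q) ^+ _]exprMn ![a ^+ i.+1]exprS ![q ^+ i.+1]exprS.
    by set p := `(i) => ? ?; field; apply/andP.
  have HE := is_sum_unique H (is_sumZ (c := z * q ^+ n) (Hl n.+1)).
  by rewrite mulrDl mul1r -HE addrC subrK.
have lE n : l 0%N = qp (- z) q n * l n.
  elim: n => [|n IH]; first by rewrite qp0 mul1r.
  by rewrite IH step qpS mulNr opprK mulrA.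
have l1 : tends_to l 1.
  apply: (is_sum_head_limit (D := B) r01 Hl).
    apply: (@tends_to_ext _ (fun=> 1)); last exact: tends_to_cst.
    by move=> n; rewrite f0.
  move=> n i; rewrite /f normrM mulrC -mulrA ler_pM// normrM.
  rewrite (le_trans (ler_piMr _ (q_le _)))// normrX exprS.
  have zn' : `|z * q ^+ n| <= r ^+ n.
    by rewrite (le_trans (zn n))// ler_piMl ?exprn_ge0// ltW.
  rewrite ler_pM ?exprn_ge0// lerXn2r ?nnegrE//.
  by rewrite (le_trans (zn n))// ler_piMr// exprn_ile1// ltW.
have -> : qpoch_inf (- z) q = l 0%N.
  rewrite -[LHS]mulr1; apply: (@tends_to_unique _ (fun n => qp (- z) q n * l n)).
    by apply: (tends_toM _ l1); exact: qp_tends_to.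
  apply: (@tends_to_ext _ (fun=> l 0%N)) => [n|]; first by rewrite (lE n).
  exact: tends_to_cst.
by apply: is_sum_ext (Hl 0%N) => i; rewrite /f mulr1.
Qed.

(** The sum does not depend on [c]; as [c] grows, only the term [s = 0] survives and it tends to the
    stated value. *)
Lemma is_sum_cauchy c :
  is_sum (fun s => q ^+ (s * s + c * s) / (`(s) * `(s + c)))
    (qpoch_inf q q)^-1.
Proof.
have [B B0 HB] := qpV_bounded q1 q1.
have r01 : 0 <= `|q| < 1 by rewrite normr_ge0.
have BB0 : 0 <= B * B by rewrite mulr_ge0 ?ltW.
pose f c s := q ^+ (s * s + c * s) / (`(s) * `(s + c)).
have fB d s : `|f d s| <= B * B * `|q ^+ (s * s + d * s)|.
  by rewrite /f normrM mulrC invfM normrM !ler_pM// mulr_ge0.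
have f_le d s : `|f d s| <= B * B * `|q| ^+ s.
  rewrite (le_trans (fB _ _))// ler_wpM2l//.
  rewrite normX_le//; nia.
have /boolp.choice[l Hl] : forall n, exists l : C, is_sum (f n) l.
  by move=> n; exact: (@geo_summable R _ (B * B) `|q| r01).
have step d : l d = l d.+1.
  (* Telescoping certificate: [f d s - f d.+1 s = A s - A s.+1] with [A 0 = 0]. *)
  pose A s := f d s * (1 - q ^+ s).
  have [a Ha] : exists a, is_sum A a.
    apply: (@geo_summable R _ (B * B * 2) `|q| r01) => s.
    rewrite /A normrM mulrAC ler_pM// (le_trans (ler_normB _ _))// normr1.
    by rewrite -[2]/(1 + 1) lerD2l normrX exprn_ile1// ltW.
  have A0 : A 0%N = 0 by rewrite /A expr0 subrr mulr0.
  suff H : is_sum (fun s => f d s - f d.+1 s) 0.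
    by apply/eqP; rewrite -subr_eq0 (is_sum_unique (is_sumB (Hl d) (Hl d.+1)) H).
  have := is_sumB Ha (is_sum_shift Ha); rewrite A0 subr0 subrr.
  apply: is_sum_ext => s; rewrite /A /f !addnS addSn !qqS.
  have := qq_neq0 s; have := subX_neq0 s.
  have := qq_neq0 (s + d); have := subX_neq0 (s + d).
  have -> : q ^+ (s.+1 * s.+1 + d * s.+1) =
      q ^+ (s * s + d * s) * q ^+ (s + d).+1 * q ^+ s.
    by rewrite -!exprD; congr (_ ^+ _); lia.
  have -> : q ^+ (s * s + d.+1 * s) = q ^+ (s * s + d * s) * q ^+ s.
    by rewrite -exprD; congr (_ ^+ _); lia.
  set u := q ^+ (s * s + d * s); set v := q ^+ (s + d).+1; set w := q ^+ s.+1.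
  move=> ? ? ? ?; field.
  by do !(apply/andP; split).
have lE d : l d = l 0%N by elim: d => // d <-.
have -> : (qpoch_inf q q)^-1 = l c.
  rewrite lE; apply: (@tends_to_unique _ l); last first.
    apply: (@tends_to_ext _ (fun=> l 0%N)) => [n|]; first by rewrite (lE n).
    exact: tends_to_cst.
  apply: (is_sum_head_limit (D := B * B) r01 Hl).
    apply: (@tends_to_ext _ (fun n => (`(n))^-1)).
      by move=> n; rewrite /f !muln0 expr0 qp0 !mul1r add0n.
    by apply: tends_toV; [exact: qpoch_inf_neq0 | exact: qp_tends_to].
  move=> n i; rewrite (le_trans (fB _ _))// -[X in _ <= X]mulrA ler_wpM2l//.
  by rewrite -exprD normX_le//; nia.
exact: Hl.
Qed.

(** A case of the q-Vandermonde sum. Induction on [M] with [c] free: the case [M.+1] at [c] reduces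
    to the case [M] at [c.+1]. *)
Lemma finite_cauchy M c :
  \sum_(s < M.+1) q ^+ (s * s + c * s) / (`(M - s) * `(s) * `(s + c)) =
  (`(M) * `(M + c))^-1.
Proof.
elim: M c => [|M IH] c.
  by rewrite big_ord1 !muln0 expr0 subnn qp0 !mul1r add0n.
rewrite [in RHS]qqS mulrAC addSnnS [in RHS]invfM -IH.
apply: (mulfI (subX_neq0 M)); rewrite [RHS]mulrCA divff ?subX_neq0// mulr1.
pose F s := q ^+ (s * s + c * s) / (`(M.+1 - s) * `(s) * `(s + c)).
rewrite big_distrr /= -(big_mkord xpredT (fun s => (1 - q ^+ M.+1) * F s)).
(* The factor is split as [1 - q ^+ M.+1 = (1 - q ^+ s) + q ^+ s * (1 - q ^+ (M.+1 - s))]. The first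
   part vanishes at [s = 0] and the second at [s = M.+1]; after a shift of the first, they combine
   term by term. *)
have -> : \sum_(0 <= s < M.+2) (1 - q ^+ M.+1) * F s =
  \sum_(0 <= s < M.+2) ((1 - q ^+ s) * F s) +
  \sum_(0 <= s < M.+2) (q ^+ s * (1 - q ^+ (M.+1 - s)) * F s).
  rewrite -big_split /=; apply: eq_big_nat => s /andP[_ sM].
  rewrite -{1}(subnKC (ltnSE sM)) exprD; ring.
rewrite big_nat_recl// expr0 subrr mul0r add0r.
rewrite [X in _ + X]big_nat_recr//= subnn expr0 subrr mulr0 mul0r addr0.
rewrite -big_split /= big_mkord; apply: eq_bigr => -[s /= sM] _; rewrite /F.
rewrite subSS subSn// !addnS addSn !qqS.
have := qq_neq0 s; have := subX_neq0 s.
have := qq_neq0 (s + c); have := subX_neq0 (s + c).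
have := qq_neq0 (M - s); have := subX_neq0 (M - s).
have -> : q ^+ (s.+1 * s.+1 + c * s.+1) =
    q ^+ (s * s + c * s) * q ^+ (s + c).+1 * q ^+ s.
  by rewrite -!exprD; congr (_ ^+ _); lia.
have -> : q ^+ (s * s + c.+1 * s) = q ^+ (s * s + c * s) * q ^+ s.
  by rewrite -exprD; congr (_ ^+ _); lia.
set u := q ^+ (s * s + c * s); set v := q ^+ (s + c).+1; set w := q ^+ s.+1.
set t := q ^+ (M - s).+1.
move=> ? ? ? ? ? ?; field.
by do !(apply/andP; split).
Qed.
End Euler.

(** * Jacobi's triple product *)

Section ThetaDiagonals.
Variable R : realType.
Local Notation C := R[i].

(** Exponent count along a diagonal: the two Euler exponents, plus the [l] coming from
    [(a * b) ^+ l], give the Cauchy exponent with offset [r]. *)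
Lemma bin2_addn r l : ('C(r + l, 2) + 'C(l, 2) + l = 'C(r, 2) + (l * l + r * l))%N.
Proof.
elim: l => [|l IH]; first by rewrite !muln0 !addn0.
by rewrite (addnS r l) !binS !bin1; lia.
Qed.

Lemma is_sum_swap (f : nat * nat -> C) l :
  is_sum f l -> is_sum (fun p => f (p.2, p.1)) l.
Proof.
move=> fl; have [||H _] := @is_sum_reindex C _ _ (fun p : nat * nat => (p.2, p.1))
   (fun p => Some (p.2, p.1)) f l.
- by case.
- by move=> [i j] H; case: (H (j, i)).
exact: H.
Qed.

Variables a b Q : C.
Hypotheses (a1 : `|a| < 1) (b1 : `|b| < 1) (abQ : a * b = Q).

Lemma norm_base_lt1 : `|Q| < 1.
Proof. by rewrite -abQ -[b]expr1 norm_mulX_lt1. Qed.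

Lemma is_sum_theta_diagonal r :
  is_sum (fun l => (- a) ^+ (r + l) * Q ^+ 'C(r + l, 2) / qp Q Q (r + l) *
                   ((- b) ^+ l * Q ^+ 'C(l, 2) / qp Q Q l))
    ((- a) ^+ r * Q ^+ 'C(r, 2) * (qpoch_inf Q Q)^-1).
Proof.
have Q1 := norm_base_lt1.
have := is_sumZ (c := (- a) ^+ r * Q ^+ 'C(r, 2)) (is_sum_cauchy Q1 r).
apply: is_sum_ext => l; rewrite invfM -!mulrA [(l + r)%N]addnC.
have -> : (- a) ^+ (r + l) = (- a) ^+ r * (- a) ^+ l by rewrite exprD.
rewrite -!mulrA; congr (_ * _).
transitivity (Q ^+ ('C(r, 2) + (l * l + r * l)) * ((qp Q Q l)^-1 * (qp Q Q (r + l))^-1)).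
  by rewrite !exprD; ring.
rewrite -bin2_addn !exprD (_ : Q ^+ l = (- a) ^+ l * (- b) ^+ l).
  by ring.
by rewrite -exprMn mulrNN abQ.
Qed.

End ThetaDiagonals.

Section JacobiTripleProduct.
Variable R : realType.
Local Notation C := R[i].
Variables a b Q : C.
Hypotheses (a1 : `|a| < 1) (b1 : `|b| < 1) (abQ : a * b = Q).

(* Multiplying the two Euler series and grouping the terms of index [(k, l)]
   by [k - l], each diagonal is summed by [is_sum_cauchy]. *)
Lemma jacobi_triple_product : exists s t,
  [/\ is_sum (fun r => (- a) ^+ r * Q ^+ 'C(r, 2)) s,
      is_sum (fun r => (- b) ^+ r.+1 * Q ^+ 'C(r.+1, 2)) t &
      s + t = qpoch_inf a Q * qpoch_inf b Q * qpoch_inf Q Q].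
Proof.
have Q1 := norm_base_lt1 a1 b1 abQ.
have baQ : b * a = Q by rewrite mulrC.
have [B B0 HB] := qpV_bounded Q1 Q1.
pose g x k := (- x) ^+ k * Q ^+ 'C(k, 2) / qp Q Q k.
have gl x : `|x| < 1 -> is_sum (g x) (qpoch_inf x Q).
  by move=> x1; rewrite -[x in qpoch_inf x]opprK; apply: is_sum_euler; rewrite ?normrN.
have [r [r01 ar br]] := common_ratio b1 a1; have [r0 r1] := andP r01.
have g_le x k : `|x| <= r -> `|g x k| <= B * r ^+ k.
  move=> xr; rewrite /g normrM mulrC ler_pM// normrM -[r ^+ k]mulr1.
  rewrite ler_pM// ?normrX ?normrN ?lerXn2r ?nnegrE//.
  by rewrite exprn_ile1// ltW.
pose f p := g a p.1 * g b p.2.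
have f_le p : `|f p| <= B * B * r ^+ (p.1 + p.2).
  by rewrite normrM exprD mulrACA ler_pM// g_le.
have dom (P : pred (nat * nat)) :
    exists s, is_sum (fun p => if P p then f p else 0) s.
  apply: (@geo_summable2 R _ (B * B) r r01) => p; case: ifP => // _.
  by rewrite normr0 (le_trans _ (f_le p)).
(* The index pairs are cut along the main diagonal, which goes to [s1]; each half is absolutely
   summable by the same majorant. *)
have [s1 H1] := dom (fun p => p.2 <= p.1)%N.
have [s2 H2] := dom (fun p => p.1 < p.2)%N.
have sE : s1 + s2 = qpoch_inf a Q * qpoch_inf b Q.
  have H : is_sum f (s1 + s2).
    apply: is_sum_ext (is_sumD H1 H2) => p /=.
    by case: leqP => _; rewrite ?addr0 ?add0r.
  have := is_sum_fubini H (fun i => is_sumZ (c := g a i) (gl b b1)).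
  have := is_sumZ (c := qpoch_inf b Q) (gl a a1).
  rewrite [qpoch_inf b Q * _]mulrC => H3 H4; apply: is_sum_unique H4 _.
  by apply: is_sum_ext H3 => i; rewrite mulrC.
have K1 : is_sum (fun r => (- a) ^+ r * Q ^+ 'C(r, 2) * (qpoch_inf Q Q)^-1) s1.
  have [||H _] := @is_sum_reindex C _ _ (fun p : nat * nat => (p.1 + p.2, p.2)%N)
    (fun p => if (p.2 <= p.1)%N then Some (p.1 - p.2, p.2)%N else None)
    (fun p => if (p.2 <= p.1)%N then f p else 0) s1.
  - by move=> [i j] /=; rewrite leq_addl addnK.
  - move=> [i j] H /=; case: leqP => // ji.
    by case: (H (i - j, j)%N); rewrite /= subnK.
  apply: is_sum_fubini (H H1) _ => i; have := is_sum_theta_diagonal a1 b1 abQ (r := i).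
  by apply: is_sum_ext => j /=; rewrite leq_addl.
(* Diagonals strictly above the main one are numbered from 0, hence the successor in the reindexing
   and in the exponents. *)
have K2 : is_sum (fun r => (- b) ^+ r.+1 * Q ^+ 'C(r.+1, 2) * (qpoch_inf Q Q)^-1) s2.
  have [||H _] := @is_sum_reindex C _ _ (fun p : nat * nat => (p.2, p.1.+1 + p.2)%N)
    (fun p => if (p.1 < p.2)%N then Some ((p.2 - p.1).-1, p.1)%N else None)
    (fun p => if (p.1 < p.2)%N then f p else 0) s2.
  - by move=> [i j] /=; rewrite addnK addSn ltnS leq_addl.
  - move=> [i j] H /=; case: ltnP => // ji.
    by case: (H ((j - i).-1, i)%N); rewrite /= prednK ?subn_gt0// subnK// ltnW.
  apply: is_sum_fubini (H H2) _ => i; have := is_sum_theta_diagonal b1 a1 baQ (r := i.+1).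
  by apply: is_sum_ext => j /=; rewrite addSn ltnS leq_addl mulrC.
have Qn0 := qpoch_inf_neq0 Q1 Q1.
exists (qpoch_inf Q Q * s1), (qpoch_inf Q Q * s2); split.
- by apply: is_sum_ext (is_sumZ (c := qpoch_inf Q Q) K1) => i; rewrite mulrC divfK.
- by apply: is_sum_ext (is_sumZ (c := qpoch_inf Q Q) K2) => i; rewrite mulrC divfK.
- by rewrite -mulrDr sE; exact: mulrC.
Qed.
End JacobiTripleProduct.

(** * The Rogers-Ramanujan identities *)

Section Bailey.
Variable R : realType.
Local Notation C := R[i].
Variable q : C.
Hypothesis q1 : `|q| < 1.
Local Notation "`( n )" := (qp q q n) (at level 0, format "`( n )").

(** For [r > 0] this merges the terms of index [r] and [- r] of the bilateral sequence
    [(-1)^r q^(r(r-1)/2)]; at 0 there is a single term, whence 1 instead of 2. *)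
Definition alpha0 r : C :=
  if r == 0%N then 1 else (-1) ^+ r * q ^+ 'C(r, 2) * (1 + q ^+ r).

(** The usual unit sequence relative to [q], multiplied by [1 - q]; it merges the indices [r] and
    [- r - 1] of the same bilateral sequence. *)
Definition alpha1 r : C := (-1) ^+ r * q ^+ 'C(r, 2) * (1 - q ^+ (r + r).+1).

(* [(alpha, 1_{n = 0})] is a Bailey pair relative to [q ^+ e], up to the
   normalisation of [alpha]. *)
Definition unit_bailey_pair (e : nat) (alpha : nat -> C) : Prop :=
  forall n, \sum_(r < n.+1) alpha r / (`(n - r) * `(n + r + e)) = (n == 0%N)%:R.

(** A closed form for the truncated sum makes induction on [m] possible; at [m = n.+1] its factor
    [1 - q ^+ (n.+1 - m)] vanishes, which is the Bailey pair relation. *)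
Lemma alpha0_partial_sum n m : (m <= n.+1)%N ->
  \sum_(r < m.+1) alpha0 r / (`(n.+1 - r) * `(n.+1 + r)) =
  (-1) ^+ m * q ^+ 'C(m.+1, 2) * (1 - q ^+ (n.+1 - m)) /
    ((1 - q ^+ n.+1) * (`(n.+1 - m) * `(n.+1 + m))).
Proof.
have n0 := subX_neq0 q1 n.
elim: m => [_|m IH mn].
  rewrite big_ord1 subn0 addn0 /alpha0 /= (_ : 'C(1, 2) = 0%N)//; have := qq_neq0 q1 n.+1.
  by move=> ?; field; apply/andP.
rewrite big_ord_recr /= IH; last exact: ltnW.
have [k nE] : exists k, n = (m + k)%N by exists (n - m)%N; rewrite subnKC.
have -> : (n.+1 - m = k.+1)%N by rewrite nE; lia.
have -> : (n.+1 - m.+1 = k)%N by rewrite nE; lia.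
have := qq_neq0 q1 k; have := qq_neq0 q1 (n.+1 + m).
have := subX_neq0 q1 k; have := subX_neq0 q1 (n.+1 + m); move: n0.
rewrite addnS (qqS q (n.+1 + m)) (qqS q k) /alpha0 /= ['C(m.+2, 2)]binS bin1.
have -> : q ^+ n.+1 = q ^+ m.+1 * q ^+ k by rewrite -exprD nE; congr (_ ^+ _); lia.
have -> : q ^+ (n.+1 + m).+1 = q ^+ m.+1 * q ^+ m.+1 * q ^+ k.
  by rewrite -!exprD nE; congr (_ ^+ _); lia.
rewrite exprD [(-1) ^+ m.+1]exprS.
set x := q ^+ m.+1; set y := q ^+ k; set z := q ^+ k.+1.
move=> ? ? ? ? ?; field.
by do !(apply/andP; split).
Qed.

Lemma unit_bailey_pair_alpha0 : unit_bailey_pair 0 alpha0.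
Proof.
case=> [|n]; first by rewrite big_ord1 /alpha0 /= !qp0 !mul1r invr1.
under eq_bigr do rewrite addn0.
by rewrite alpha0_partial_sum// subnn expr0 subrr mulr0 mul0r.
Qed.

Lemma alpha1_partial_sum n m : (m <= n.+1)%N ->
  \sum_(r < m.+1) alpha1 r / (`(n.+1 - r) * `(n.+1 + r + 1)) =
  (-1) ^+ m * q ^+ 'C(m.+1, 2) * (1 - q ^+ m.+1) * (1 - q ^+ (n.+1 - m)) /
    ((1 - q ^+ n.+1) * (`(n.+1 - m) * `((n.+1 + m).+1))).
Proof.
have n0 := subX_neq0 q1 n.
elim: m => [_|m IH mn].
  rewrite big_ord1 subn0 addn0 addn1 /alpha1 /=.
  rewrite (_ : 'C(1, 2) = 0%N)// (_ : 'C(0, 2) = 0%N)//; have := qq_neq0 q1 n.+1.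
  have := qq_neq0 q1 n.+2.
  by move=> ? ?; field; do !(apply/andP; split).
rewrite big_ord_recr /= IH; last exact: ltnW.
have [k nE] : exists k, n = (m + k)%N by exists (n - m)%N; rewrite subnKC.
have -> : (n.+1 - m = k.+1)%N by rewrite nE; lia.
have -> : (n.+1 - m.+1 = k)%N by rewrite nE; lia.
have := qq_neq0 q1 k; have := qq_neq0 q1 (n.+1 + m).+1.
have := subX_neq0 q1 k; have := subX_neq0 q1 (n.+1 + m).+1; move: n0.
rewrite addn1 addnS (qqS q (n.+1 + m).+1) (qqS q k) /alpha1 ['C(m.+2, 2)]binS bin1.
have -> : q ^+ n.+1 = q ^+ m.+1 * q ^+ k by rewrite -exprD nE; congr (_ ^+ _); lia.
have -> : q ^+ (n.+1 + m).+2 = q ^+ m.+1 * q ^+ m.+1 * q ^+ k * q.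
  by rewrite -!exprD -exprSr nE; congr (_ ^+ _); lia.
have -> : q ^+ (m.+1 + m.+1).+1 = q ^+ m.+1 * q ^+ m.+1 * q.
  by rewrite -!exprD -exprSr.
rewrite exprD [(-1) ^+ m.+1]exprS [q ^+ m.+2]exprS [q ^+ k.+1]exprS.
set x := q ^+ m.+1; set y := q ^+ k.
move=> ? ? ? ? ?; field.
by do !(apply/andP; split).
Qed.

Lemma unit_bailey_pair_alpha1 : unit_bailey_pair 1 alpha1.
Proof.
case=> [|n].
  rewrite big_ord1 /alpha1 /= !qqS !qp0 !mul1r expr1 divff//.
  by have := subX_neq0 q1 0; rewrite expr1.
by rewrite alpha1_partial_sum// subnn expr0 subrr mulr0 mul0r.
Qed.

Lemma sum_triangle (F : nat -> nat -> C) n :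
  \sum_(k < n) \sum_(r < k.+1) F k r = \sum_(r < n) \sum_(s < n - r) F (r + s)%N r.
Proof.
elim: n => [|n IH]; first by rewrite !big_ord0.
rewrite big_ord_recr /= IH [in RHS]big_ord_recr /= subSnn big_ord1 addn0.
rewrite [X in _ + X]big_ord_recr /= addrA; congr (_ + _).
rewrite -big_split /=; apply: eq_bigr => -[r /= rn] _.
by rewrite subSn ?(ltnW rn)// big_ord_recr /= subnKC// ltnW.
Qed.

(** * Two applications of the Bailey lemma *)

Section Pair.
Variables (e : nat) (alpha : nat -> C) (D : C).
Hypothesis pair : unit_bailey_pair e alpha.
Hypothesis alpha_le : forall r, `|alpha r| <= D.

(** First application: weighting the pair relations by [q ^+ (k * k + e * k) / (q)_{n-k}] and
    summing over [k] leaves only [k = 0] on the unit side. On the other side, [k = r + s] turns the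
    inner sum into [finite_cauchy] with offset [2r + e]. *)
Lemma bailey_step n :
  \sum_(r < n.+1) q ^+ (r * r + e * r) * alpha r / (`(n - r) * `(n + r + e)) =
  (`(n))^-1.
Proof.
transitivity (\sum_(k < n.+1) q ^+ (k * k + e * k) / `(n - k) * (k == 0%N :> nat)%:R : C).
  under [RHS]eq_bigr do rewrite -pair big_distrr /=.
  rewrite (sum_triangle (fun k r => q ^+ (k * k + e * k) / `(n - k) *
     (alpha r / (`(k - r) * `(k + r + e))))).
  apply: eq_bigr => -[r /= rn] _; rewrite subSn ?(ltnSE rn)//.
  rewrite (_ : n + r + e = n - r + (r + r + e))%N; last by lia.
  rewrite -(finite_cauchy q1) big_distrr /=; apply: eq_bigr => -[s /= sn] _.
  rewrite (_ : r + s - r = s)%N; last by lia.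
  rewrite (_ : n - (r + s) = n - r - s)%N; last by lia.
  rewrite (_ : r + s + r + e = s + (r + r + e))%N; last by lia.
  rewrite (_ : q ^+ ((r + s) * (r + s) + e * (r + s)) =
     q ^+ (r * r + e * r) * q ^+ (s * s + (r + r + e) * s)); last first.
    by rewrite -exprD; congr (_ ^+ _); lia.
  by rewrite !invfM; ring.
rewrite big_ord_recl /= !muln0 expr0 mul1r mulr1 subn0 big1 ?addr0// => i _.
by rewrite mulr0.
Qed.

(** Second application, in the limit: the double series [F'] is summed over [r] by [bailey_step] and
    over [k] by [is_sum_cauchy]. The bound on [alpha] justifies the interchange. *)
Lemma bailey_limit : exists s,
  is_sum (fun n => q ^+ (n * n + e * n) / `(n)) s /\
  is_sum (fun r => q ^+ (2 * (r * r + e * r)) * alpha r) (qpoch_inf q q * s).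
Proof.
have [B B0 HB] := qpV_bounded q1 q1.
have D0 : 0 <= D by apply: le_trans (alpha_le 0%N).
pose F k r := q ^+ (k * k + e * k) *
  (q ^+ (r * r + e * r) * alpha r / (`(k - r) * `(k + r + e))).
(* The guard is essential: for [r > k] the truncated subtraction [k - r] would give 0 and leave
   spurious terms. *)
pose F' p := if (p.2 <= p.1)%N then F p.1 p.2 else 0.
have Xle m : `|q ^+ (m * m + e * m)| <= `|q| ^+ m by apply: normX_le => //; nia.
have [s Fs] : exists s, is_sum F' s.
  apply: (@geo_summable2 R _ (D * (B * B)) `|q|); first by rewrite normr_ge0.
  move=> p; rewrite /F'; case: ifP => _; last first.
    by rewrite normr0 !mulr_ge0 ?exprn_ge0// ltW.
  rewrite exprD [X in _ <= X]mulrCA /F normrM ler_pM//.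
  rewrite normrM normrM invfM normrM -mulrA [X in _ <= X]mulrC ler_pM//.
    by rewrite ?mulr_ge0.
  by rewrite ler_pM// ?mulr_ge0// ler_pM.
exists s; split.
  apply: is_sum_fubini Fs _ => k; rewrite -bailey_step big_distrr /=.
  have := @is_sum_prefix C (fun r => F' (k, r)) k.+1.
  rewrite (eq_bigr (fun r : 'I_k.+1 => F k r)).
    by apply=> i ki; rewrite /F' /= leqNgt ki.
  by move=> [r rk] _; rewrite /F' /= -ltnS rk.
have qn0 := qpoch_inf_neq0 q1 q1.
suff H : is_sum (fun r => q ^+ (2 * (r * r + e * r)) * alpha r * (qpoch_inf q q)^-1) s.
  by apply: is_sum_ext (is_sumZ (c := qpoch_inf q q) H) => r; rewrite mulrC divfK.
apply: is_sum_fubini (is_sum_swap Fs) _ => r /=.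
have [||_ H] := @is_sum_reindex C _ _ (fun s => r + s)%N
    (fun k => if (r <= k)%N then Some (k - r)%N else None)
    (fun k => F' (k, r)) (q ^+ (2 * (r * r + e * r)) * alpha r * (qpoch_inf q q)^-1).
- by move=> k /=; rewrite leq_addr addKn.
- by move=> k H; rewrite /F' /=; case: leqP => // rk; case: (H (k - r)%N); rewrite subnKC.
apply: H.
have := is_sumZ (c := q ^+ (2 * (r * r + e * r)) * alpha r)
  (is_sum_cauchy q1 (r + r + e)).
apply: is_sum_ext => t; rewrite /= /F' /= leq_addr /F addKn.
rewrite (_ : r + t + r + e = t + (r + r + e))%N; last by lia.
have -> : q ^+ ((r + t) * (r + t) + e * (r + t)) =
     q ^+ (r * r + e * r) * q ^+ (t * t + (r + r + e) * t).
  by rewrite -exprD; congr (_ ^+ _); lia.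
by rewrite mul2n -addnn exprD; ring.
Qed.
End Pair.

(** * Evaluation of the two theta series *)

Lemma alpha0_le r : `|alpha0 r| <= 2.
Proof.
have X1 m : `|q ^+ m| <= 1 by rewrite normrX exprn_ile1// ltW.
rewrite /alpha0; case: eqP => _; first by rewrite normr1 ler1n.
rewrite !normrM normrX normrN1 expr1n mul1r -[2]mul1r ler_pM//.
by rewrite (le_trans (ler_normD _ _))// normr1 -[2]/(1 + 1) lerD2l.
Qed.

Lemma alpha1_le r : `|alpha1 r| <= 2.
Proof.
have X1 m : `|q ^+ m| <= 1 by rewrite normrX exprn_ile1// ltW.
rewrite /alpha1 !normrM normrX normrN1 expr1n mul1r -[2]mul1r ler_pM//.
by rewrite (le_trans (ler_normB _ _))// normr1 -[2]/(1 + 1) lerD2l.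
Qed.

(** The factors [1 - q ^+ k] are sorted by the residue of [k] modulo 5, and the limit is taken along
    partial products of length [n * 5]. *)
Lemma qpoch_inf_split5 : qpoch_inf q q =
  (qpoch_inf q (q ^+ 5) * qpoch_inf (q ^+ 4) (q ^+ 5)) *
  (qpoch_inf (q ^+ 2) (q ^+ 5) * qpoch_inf (q ^+ 3) (q ^+ 5)) *
  qpoch_inf (q ^+ 5) (q ^+ 5).
Proof.
have q51 : `|q ^+ 5| < 1 by rewrite exprS norm_mulX_lt1.
apply: (@tends_to_unique _ (fun n => qp q q (n * 5))).
  by apply: tends_to_subseq (qp_tends_to q1) => n; rewrite leq_pmulr.
apply: (@tends_to_ext _ (fun n => (qp q (q ^+ 5) n * qp (q ^+ 4) (q ^+ 5) n) *
  (qp (q ^+ 2) (q ^+ 5) n * qp (q ^+ 3) (q ^+ 5) n) * qp (q ^+ 5) (q ^+ 5) n)).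
  elim=> [|n IH]; first by rewrite !qp0 !mulr1.
  rewrite mulSn addnC !addnS addn0 !qqS -IH !qpS.
  have X m : q ^+ m * q ^+ 5 ^+ n = q ^+ (n * 5 + m).
    by rewrite -exprM -exprD; congr (_ ^+ _); lia.
  have X' : q * q ^+ 5 ^+ n = q ^+ (n * 5 + 1) by rewrite -X expr1.
  by rewrite [q ^+ 5 ^+ n.+1]exprS X' !X !addnS !addn0; ring.
by apply: tends_toM; [apply: tends_toM; apply: tends_toM|]; exact: qp_tends_to.
Qed.

Lemma inv_of_cancel (u v w s : C) : u != 0 -> v != 0 -> w != 0 ->
  u * v * w * s = v * w -> u^-1 = s.
Proof.
move=> u0 v0 w0 H; apply: (mulfI (mulf_neq0 v0 w0)); apply: (mulfI u0).
by rewrite mulrCA divff// mulr1 -{1}H; ring.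
Qed.

Lemma inv_of_cancelC (u v1 v2 w s : C) :
  u != 0 -> v1 != 0 -> v2 != 0 -> w != 0 ->
  v1 * v2 * u * w * s = v2 * v1 * w -> u^-1 = s.
Proof.
move=> u0 v10 v20 w0; rewrite (mulrC v2) (mulrC _ u).
exact: inv_of_cancel u0 (mulf_neq0 v10 v20) w0.
Qed.

Lemma rogers_ramanujan1 : is_sum (fun n => q ^+ (n * n) / `(n))
  (qpoch_inf q (q ^+ 5) * qpoch_inf (q ^+ 4) (q ^+ 5))^-1.
Proof.
have X1 m : `|q ^+ m.+1| < 1 by rewrite exprS norm_mulX_lt1.
have [s [H1 H2]] := bailey_limit unit_bailey_pair_alpha0 alpha0_le.
(* The parameters [q ^+ 2] and [q ^+ 3] are read off from [E2] below: the theta exponent is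
   [5 * 'C(m, 2) + 2 * m], and the factor [1 + q ^+ m] adds the terms with [3 * m]. *)
have [|u [v [Hu Hv uv]]] := jacobi_triple_product (X1 1%N) (X1 2%N) (Q := q ^+ 5).
  by rewrite -exprD.
have E2 m : (2 * (m * m) + 'C(m, 2) = 5 * 'C(m, 2) + 2 * m)%N.
  by elim: m => [|m IH]//; rewrite !binS !bin1; lia.
(* Removing the first half [u] from the Bailey series cancels the common head term 1, so the
   remainder, shifted by one, is the second half. *)
have /(is_sum_unique Hv) vE : is_sum (fun r => (- q ^+ 3) ^+ r.+1 * q ^+ 5 ^+ 'C(r.+1, 2))
    (qpoch_inf q q * s - u).
  have := is_sum_shift (is_sumB H2 Hu).
  rewrite /alpha0 /= !expr0 !mulr1 subrr subr0; apply: is_sum_ext => r.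
  rewrite mul0n addn0 ![(- q ^+ _) ^+ _]exprNn -!exprM.
  transitivity ((-1) ^+ r.+1 * (q ^+ (2 * (r.+1 * r.+1) + 'C(r.+1, 2)) * (1 + q ^+ r.+1)
     - q ^+ (2 * r.+1) * q ^+ (5 * 'C(r.+1, 2)))).
    by rewrite exprD; ring.
  rewrite E2 -[X in X - _]mulrC mulrDl mul1r [q ^+ (5 * _ + _)]exprD.
  rewrite (_ : 3 * r.+1 = 2 * r.+1 + r.+1)%N; last by lia.
  by rewrite [q ^+ (2 * r.+1 + _)]exprD; ring.
have sE : qpoch_inf q q * s = qpoch_inf (q ^+ 2) (q ^+ 5) * qpoch_inf (q ^+ 3) (q ^+ 5)
   * qpoch_inf (q ^+ 5) (q ^+ 5) by rewrite -uv vE addrC subrK.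
have := sE; rewrite qpoch_inf_split5.
have p1 : qpoch_inf q (q ^+ 5) != 0 by exact: qpoch_inf_neq0.
have p2 : qpoch_inf (q ^+ 2) (q ^+ 5) != 0 by exact: qpoch_inf_neq0.
have p3 : qpoch_inf (q ^+ 3) (q ^+ 5) != 0 by exact: qpoch_inf_neq0.
have p4 : qpoch_inf (q ^+ 4) (q ^+ 5) != 0 by exact: qpoch_inf_neq0.
have p5 : qpoch_inf (q ^+ 5) (q ^+ 5) != 0 by exact: qpoch_inf_neq0.
move=> /(inv_of_cancel (mulf_neq0 p1 p4) (mulf_neq0 p2 p3) p5) ->.
by apply: is_sum_ext H1 => n; rewrite mul0n addn0.
Qed.

Lemma rogers_ramanujan2 : is_sum (fun n => q ^+ (n * n + n) / `(n))
  (qpoch_inf (q ^+ 2) (q ^+ 5) * qpoch_inf (q ^+ 3) (q ^+ 5))^-1.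
Proof.
have X1 m : `|q ^+ m.+1| < 1 by rewrite exprS norm_mulX_lt1.
have [s [H1 H2]] := bailey_limit unit_bailey_pair_alpha1 alpha1_le.
have [|u [v [Hu Hv uv]]] := jacobi_triple_product (X1 3%N) q1 (Q := q ^+ 5).
  by rewrite -exprSr.
have E2 m : (2 * (m * m + 1 * m) + 'C(m, 2) = 5 * 'C(m, 2) + 4 * m)%N.
  by elim: m => [|m IH]//; rewrite !binS !bin1; lia.
(* Here the factor [1 - q ^+ (r + r).+1] pairs the [r]-th terms of both halves, so they add up
   without a shift. *)
have /(is_sum_unique H2) sE : is_sum (fun r => q ^+ (2 * (r * r + 1 * r)) * alpha1 r)
    (u + v).
  apply: is_sum_ext (is_sumD Hu Hv) => r.
  rewrite /alpha1 [(- q ^+ 4) ^+ _]exprNn [(- q) ^+ _]exprNn -!exprM.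
  transitivity ((-1) ^+ r * (q ^+ (2 * (r * r + 1 * r) + 'C(r, 2)) * (1 - q ^+ (r + r).+1)));
    last by rewrite [q ^+ (2 * _ + _)]exprD; ring.
  have -> : q ^+ (5 * 'C(r.+1, 2)) = q ^+ (5 * 'C(r, 2)) * q ^+ (4 * r) * q ^+ r.
    by rewrite -!exprD binS bin1; congr (_ ^+ _); lia.
  rewrite E2 exprD [(-1) ^+ r.+1]exprS [q ^+ (r + r).+1]exprS [q ^+ (r + r)]exprD.
  by rewrite [q ^+ r.+1]exprS; ring.
have := sE; rewrite uv qpoch_inf_split5.
have p1 : qpoch_inf q (q ^+ 5) != 0 by exact: qpoch_inf_neq0.
have p2 : qpoch_inf (q ^+ 2) (q ^+ 5) != 0 by exact: qpoch_inf_neq0.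
have p3 : qpoch_inf (q ^+ 3) (q ^+ 5) != 0 by exact: qpoch_inf_neq0.
have p4 : qpoch_inf (q ^+ 4) (q ^+ 5) != 0 by exact: qpoch_inf_neq0.
have p5 : qpoch_inf (q ^+ 5) (q ^+ 5) != 0 by exact: qpoch_inf_neq0.
move=> /(inv_of_cancelC (mulf_neq0 p2 p3) p1 p4 p5) ->.
by apply: is_sum_ext H1 => n; rewrite mul1n.
Qed.
End Bailey.

(** * The double sums *)

Section DoubleSum.
Variable R : realType.
Local Notation C := R[i].

Lemma is_sum_even_part (z l l' : C) (c : nat -> C) :
  is_sum (fun k => z ^+ k * c k) l -> is_sum (fun k => (- z) ^+ k * c k) l' ->
  is_sum (fun m => (z ^+ 2) ^+ m * c (2 * m)%N) ((l + l') / 2).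
Proof.
move=> zl zl'; pose f k := z ^+ k * c k + (- z) ^+ k * c k.
have [||H _] := @is_sum_reindex C _ _ (fun m => 2 * m)%N
    (fun k => if odd k then None else Some k./2) f (l + l').
- by move=> m /=; rewrite mul2n odd_double doubleK.
- move=> k H; have [ok|ek] := boolP (odd k).
    by rewrite /f exprNn -signr_odd ok expr1 mulN1r mulNr subrr.
  by case: (H k./2); rewrite mul2n even_halfK.
have := is_sumZ (c := 2^-1) (H (is_sumD zl zl')); rewrite mulrC.
apply: is_sum_ext => m /=; rewrite /f !exprM sqrrN -mulr2n.
by rewrite -[X in _ * X]mulr_natl mulKf// pnatr_eq0.
Qed.

Variable q : C.
Hypothesis q1 : `|q| < 1.
Local Notation "`( n )" := (qp q q n) (at level 0, format "`( n )").
Local Notation P := (qpoch_inf q (q ^+ 2)).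

Lemma normX_lt1 n : `|q ^+ n.+1| < 1.
Proof. by rewrite exprS norm_mulX_lt1. Qed.

Lemma qpoch_inf_sqr (z : C) :
  qpoch_inf z q * qpoch_inf (- z) q = qpoch_inf (z ^+ 2) (q ^+ 2).
Proof.
apply: (@tends_to_unique _ (fun n => qp z q n * qp (- z) q n)).
  by apply: tends_toM; exact: qp_tends_to.
apply: (@tends_to_ext _ (qp (z ^+ 2) (q ^+ 2))); last exact/qp_tends_to/normX_lt1.
move=> n; rewrite /qp -big_split /=; apply: eq_bigr => k _.
by rewrite mulNr opprK -exprM mulnC exprM; ring.
Qed.

(* [1 / (z; q)_oo = (- z; q)_oo / (z^2; q^2)_oo] with [z^2 = w]. *)
Lemma is_sum_even (w : C) : `|w| < 1 -> exists s,
  is_sum (fun m => w ^+ m * (q ^+ 'C(2 * m, 2) / `(2 * m))) s /\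
  is_sum (fun j => w ^+ j * (`(2 * j))^-1) (s / qpoch_inf w (q ^+ 2)).
Proof.
move=> w1; pose z := sqrtC w; have zw : z ^+ 2 = w by rewrite sqrtCK.
have z1 : `|z| < 1.
  by rewrite -(@expr_lt1 _ 2)// -normrX zw.
have z1' : `|- z| < 1 by rewrite normrN.
exists ((qpoch_inf (- z) q + qpoch_inf z q) / 2); split.
  rewrite -zw; apply: (@is_sum_even_part z _ _ (fun k => q ^+ 'C(k, 2) / `(k))).
    by apply: is_sum_ext (is_sum_euler q1 z1) => k; rewrite mulrA.
  rewrite -[z in qpoch_inf z]opprK.
  by apply: is_sum_ext (is_sum_euler q1 z1') => k; rewrite mulrA.
have := is_sum_even_part (c := fun k => (`(k))^-1) (is_sum_euler_inv q1 z1)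
  (is_sum_euler_inv q1 z1').
rewrite -zw -qpoch_inf_sqr.
have := qpoch_inf_neq0 z1 q1; have := qpoch_inf_neq0 z1' q1.
move: (qpoch_inf z q) (qpoch_inf (- z) q) => x y y0 x0.
(* The even part of the inverse product has the same numerator as the even part of the product, over
   the common denominator [(z; q)_oo (- z; q)_oo]. *)
rewrite (_ : (x^-1 + y^-1) / 2 = (y + x) / 2 / (x * y))//.
by field; rewrite x0 y0.
Qed.

(** The factors are separated by the parity of their exponents; [e] covers both parities of the
    length. *)
Lemma qp_even_odd e i : (e <= 1)%N ->
  `(2 * i + e) = qp q (q ^+ 2) (i + e) * qp (q ^+ 2) (q ^+ 2) i.
Proof.
have even : `(2 * i) = qp q (q ^+ 2) i * qp (q ^+ 2) (q ^+ 2) i.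
  elim: i => [|i IH]; first by rewrite muln0 !qp0 mulr1.
  rewrite mulnS !addSn add0n (qqS q (2 * i).+1) (qqS q (2 * i)) IH.
  rewrite (qpS q (q ^+ 2)) (qqS (q ^+ 2)) -!exprM -exprS mulnS !addSn add0n.
  by ring.
case: e => [|[|//]] _; first by rewrite !addn0.
by rewrite !addn1 qqS even (qpS q) -exprM -exprS mulrAC.
Qed.

Lemma qpoch_inf_tail n : qpoch_inf (q * q ^+ 2 ^+ n) (q ^+ 2) = P / qp q (q ^+ 2) n.
Proof.
have q21 := normX_lt1 1.
by rewrite (qpoch_infM q n q21) mulrAC divff ?mul1r// qp_neq0.
Qed.

Lemma double_sum_rogers_ramanujan e s : (e <= 1)%N ->
  is_sum (fun n => (q ^+ 2) ^+ (n * n + e * n) / qp (q ^+ 2) (q ^+ 2) n) s ->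
  is_sum (fun p => q ^+ (2 * p.1 * p.2 + p.1 + (2 * e + 1) * p.2) /
                   (`(2 * p.1 + e) * `(2 * p.2))) (s / P ^+ 2).
Proof.
move=> e1 rr; have q21 := normX_lt1 1; have P0 := qpoch_inf_neq0 q1 q21.
have [B B0 HB] := qpV_bounded q1 q1; have [B' B'0 HB'] := qpV_bounded q21 q21.
have r01 : 0 <= `|q| < 1 by rewrite normr_ge0.
pose f p := q ^+ (2 * p.1 * p.2 + p.1 + (2 * e + 1) * p.2) /
                   (`(2 * p.1 + e) * `(2 * p.2)).
(* The intermediate series, indexed by [i] and [m]: [f] summed over [j] equals [P^-1] times [g]
   summed over [m]. *)
pose g p := q ^+ (p.1 + 2 * (p.2 * p.2 + e * p.2) + 2 * p.1 * p.2) /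
                   (qp (q ^+ 2) (q ^+ 2) p.1 * `(2 * p.2)).
have [sf Hf] : exists sf, is_sum f sf.
  apply: (@geo_summable2 R _ (B * B) `|q| r01) => p.
  rewrite /f normrM invfM normrM mulrC ler_pM ?mulr_ge0//; first by rewrite ler_pM.
  by apply: normX_le => //; nia.
have [sg Hg] : exists sg, is_sum g sg.
  apply: (@geo_summable2 R _ (B' * B) `|q| r01) => p.
  rewrite /g normrM invfM normrM mulrC ler_pM ?mulr_ge0//; first by rewrite ler_pM.
  by apply: normX_le => //; nia.
have w1 n : `|q * q ^+ 2 ^+ n| < 1 by exact: norm_mulX_lt1.
have /boolp.choice[E HE] i := is_sum_even (w1 (i + e)%N).
pose G i := q ^+ i / qp (q ^+ 2) (q ^+ 2) i * E i.
have HG : is_sum G sg.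
  apply: is_sum_fubini Hg _ => i.
  have [H _] := HE i; have := is_sumZ (c := q ^+ i / qp (q ^+ 2) (q ^+ 2) i) H.
  apply: is_sum_ext => m; rewrite /g /= invfM.
  have -> : q ^+ (i + 2 * (m * m + e * m) + 2 * i * m) =
      q ^+ i * ((q * q ^+ 2 ^+ (i + e)) ^+ m * q ^+ 'C(2 * m, 2)).
    rewrite -exprM -exprS -exprM -!exprD; congr (_ ^+ _).
    have : ('C(2 * m, 2) + m = 2 * (m * m))%N.
      elim: m => [|m IH]//; rewrite (_ : 2 * m.+1 = (2 * m).+2)%N; last by lia.
      by rewrite !binS !bin1 !bin0; lia.
    by move: 'C(2 * m, 2); nia.
  by ring.
have sfE : sf = P^-1 * sg.
  apply: is_sum_unique (is_sumZ (c := P^-1) HG); apply: is_sum_fubini Hf _ => i.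
  have [_ H] := HE i; have := is_sumZ (c := q ^+ i / `(2 * i + e)) H.
  have -> : q ^+ i / `(2 * i + e) * (E i / qpoch_inf (q * q ^+ 2 ^+ (i + e)) (q ^+ 2)) =
    P^-1 * G i.
    rewrite /G qpoch_inf_tail qp_even_odd//.
    have := qp_neq0 (i + e) q1 q21; have := qp_neq0 i q21 q21.
    move: P (qp _ _ (i + e)) (qp _ _ i) P0 => x y z x0 z0 y0; field.
    by rewrite x0 y0 z0.
  apply: is_sum_ext => j; rewrite /f /= invfM.
  have -> : q ^+ (2 * i * j + i + (2 * e + 1) * j) = q ^+ i * (q * q ^+ 2 ^+ (i + e)) ^+ j.
    by rewrite -exprM -exprS -exprM -exprD; congr (_ ^+ _); lia.
  by ring.
(* Summing [g] over [i] first, by Euler's series in base [q ^+ 2], leaves the Rogers-Ramanujan sum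
   and produces the second factor [P^-1]. *)
have sgE : sg = P^-1 * s.
  apply: is_sum_unique (is_sumZ (c := P^-1) rr).
  apply: is_sum_fubini (is_sum_swap Hg) _ => m.
  have := is_sumZ (c := q ^+ (2 * (m * m + e * m)) / `(2 * m))
    (is_sum_euler_inv q21 (w1 m)).
  have -> : q ^+ (2 * (m * m + e * m)) / `(2 * m) *
      (qpoch_inf (q * q ^+ 2 ^+ m) (q ^+ 2))^-1 =
      P^-1 * (q ^+ 2 ^+ (m * m + e * m) / qp (q ^+ 2) (q ^+ 2) m).
    rewrite qpoch_inf_tail -exprM -[X in qp q q X]addn0 qp_even_odd// addn0.
    have := qp_neq0 m q1 q21; have := qp_neq0 m q21 q21.
    move: P (qp q _ m) (qp (q ^+ 2) _ m) P0 => x y z x0 z0 y0; field.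
    by rewrite x0 y0 z0.
  apply: is_sum_ext => i; rewrite /g /= invfM.
  have -> : q ^+ (i + 2 * (m * m + e * m) + 2 * i * m) =
      q ^+ (2 * (m * m + e * m)) * (q * q ^+ 2 ^+ m) ^+ i.
    by rewrite -exprM -exprS -exprM -exprD; congr (_ ^+ _); lia.
  by ring.
have -> : s / P ^+ 2 = sf by rewrite sfE sgE mulrA -invfM mulrC expr2.
exact: Hf.
Qed.

End DoubleSum.

Theorem theorem1p1 (R : realType) (q : R[i]) (hq : `|q| < 1) :
  is_double_sum
    (fun i j : nat =>
       q ^+ (2 * i * j + i + j) / (qpoch q q (2 * i) * qpoch q q (2 * j)))
    (1 / (qpoch_inf q (q ^+ 2) ^+ 2
          * qpochs_inf [:: q ^+ 2; q ^+ 8] (q ^+ 10)))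
  /\
  is_double_sum
    (fun i j : nat =>
       q ^+ (2 * i * j + i + 3 * j)
         / (qpoch q q (2 * i + 1) * qpoch q q (2 * j)))
    (1 / (qpoch_inf q (q ^+ 2) ^+ 2
          * qpochs_inf [:: q ^+ 4; q ^+ 6] (q ^+ 10))).
Proof.
have q21 : `|q ^+ 2| < 1 by exact: normX_lt1.
split; rewrite /qpochs_inf big_cons big_seq1 div1r invfM mulrC.
  (* The two claims are the cases [e = 0] and [e = 1]; in base [q ^+ 2] the Rogers-Ramanujan
     products modulo 5 become products in base [q ^+ 10]. *)
  have H : is_sum (fun n => (q ^+ 2) ^+ (n * n + 0 * n) / qp (q ^+ 2) (q ^+ 2) n)
      (qpoch_inf (q ^+ 2) (q ^+ 10) * qpoch_inf (q ^+ 8) (q ^+ 10))^-1.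
    have := rogers_ramanujan1 q21; rewrite -!exprM.
    by apply: is_sum_ext => n; rewrite mul0n addn0.
  apply: is_sum_ext (double_sum_rogers_ramanujan hq (leq0n 1) H) => -[i j] /=.
  by rewrite !qpochE// addn0 mul1n.
have H : is_sum (fun n => (q ^+ 2) ^+ (n * n + 1 * n) / qp (q ^+ 2) (q ^+ 2) n)
    (qpoch_inf (q ^+ 4) (q ^+ 10) * qpoch_inf (q ^+ 6) (q ^+ 10))^-1.
  have := rogers_ramanujan2 q21; rewrite -!exprM.
  by apply: is_sum_ext => n; rewrite mul1n.
apply: is_sum_ext (double_sum_rogers_ramanujan hq (leqnn 1) H) => -[i j] /=.
by rewrite !qpochE.
Qed.
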